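(* Let $x_1,\dots,x_d\in\mathbb{C}$ be the possible values of a complex random variable. Then $$\max_{p} \sum_{i=1}^d p_i\Big|x_i-\sum_{j=1}^d p_j x_j\Big|^2 = \min_{y\in\mathbb{C}}\ \max_{1\le i\le d} |x_i-y|^2,$$ where the maximum on the left is over all probability vectors $p=(p_1,\dots,p_d)$ (i.e. $p_i\ge 0$ and $\sum_i p_i=1$).
   Context: The variance of a complex random variable $X$ that takes the value $x_i\in\mathbb{C}$ with probability $p_i$ is defined as $\mathrm{Var}(X)=\sum_i p_i|x_i|^2-\big|\sum_i p_ix_i\big|^2=\sum_i p_i\big|x_i-\sum_j p_jx_j\big|^2$. *)

(* Defs.v *)
From HB Require Import structures.
From mathcomp Require Import all_boot all_order all_algebra.
From mathcomp Require Import all_classical all_reals all_analysis.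
From mathcomp Require Import complex.

Set Implicit Arguments.
Unset Strict Implicit.
Unset Printing Implicit Defensive.

Import Order.TTheory GRing.Theory Num.Theory.

Local Open Scope classical_set_scope.
Local Open Scope ring_scope.
Local Open Scope complex_scope.

(* Attained extrema: existence of the maximum or minimum is part of the
   predicate. *)
Definition is_maximum (R : realType) (S : set R) (m : R) : Prop :=
  S m /\ ubound S m.

Definition is_minimum (R : realType) (S : set R) (m : R) : Prop :=
  S m /\ lbound S m.

(* The R-valued modulus of a complex number; the norm `|z| of mathcomp takes
   its values in R[i] itself. *)
Definition cmod (R : realType) (z : R[i]) : R := ComplexField.Normc.normc z.

Definition prob_vectors (R : realType) (d : nat) : set 'rV[R]_d :=
  [set p | (forall i, 0 <= p ord0 i) /\ \sum_(i < d) p ord0 i = 1].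

Definition cmean (R : realType) (d : nat) (x : 'I_d -> R[i]) (p : 'rV[R]_d)
  : R[i] := \sum_(j < d) (p ord0 j)%:C * x j.

Definition cvariance (R : realType) (d : nat) (x : 'I_d -> R[i]) (p : 'rV[R]_d)
  : R := \sum_(i < d) p ord0 i * cmod (x i - cmean x p) ^+ 2.

(* For d > 0 the default value 0 is harmless, all the terms being
   nonnegative. *)
Definition max_sqdist (R : realType) (d : nat) (x : 'I_d -> R[i]) (y : R[i])
  : R := \big[Num.max/0]_(i < d) cmod (x i - y) ^+ 2.

(* Main.v *)
Require Import Defs.
From HB Require Import structures.
From mathcomp Require Import all_boot all_order all_algebra.
From mathcomp Require Import all_classical all_reals all_analysis.
From mathcomp Require Import complex.
From mathcomp Require Import ring lra.
Import Order.TTheory GRing.Theory Num.Theory.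
Import numFieldNormedType.Exports.
Local Open Scope classical_set_scope.
Local Open Scope ring_scope.
Local Open Scope complex_scope.

(** The variance is at most the mean squared distance to any point [y], hence at
    most the largest squared distance to [y]: every value on the left-hand side
    is below every value on the right-hand side.  It therefore suffices to find
    one [p] and one [y] at which the two sides meet.

    The simplex of probability vectors is compact and the variance is
    continuous, so some [p] maximizes it; take for [y] the mean [m] of [p].
    When [p] is moved towards the vertex at index [i], with weight [t], the
    variance becomes (1 - t) V + t (1 - t) |x_i - m|^2, where [V] is its value
    at [p] ([cvariance_toward_vertex]).  Since [V] is maximal, this is at most
    [V], i.e. (1 - t) |x_i - m|^2 <= V for 0 < t <= 1; letting [t] tend to 0
    gives |x_i - m|^2 <= V for every [i] ([cvariance_maximizer_sqdist]).  So
    the largest squared distance to [m] is at most [V], and the two sides agree.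

    Geometrically, the centre of the smallest disc enclosing the points is the
    mean of a variance-maximizing probability vector. *)

Lemma cmod_sqr (R : realType) (z : R[i]) :
  cmod z ^+ 2 = complex.Re z ^+ 2 + complex.Im z ^+ 2.
Proof. by case: z => a b; rewrite /cmod/= sqr_sqrtr// addr_ge0 ?sqr_ge0. Qed.

Lemma cmod_sqrB (R : realType) (z w : R[i]) :
  cmod (z - w) ^+ 2 =
  (complex.Re z - complex.Re w) ^+ 2 + (complex.Im z - complex.Im w) ^+ 2.
Proof. by rewrite cmod_sqr; case: z; case: w. Qed.

Lemma Re_cmean (R : realType) (d : nat) (x : 'I_d -> R[i]) (p : 'rV[R]_d) :
  complex.Re (cmean x p) = \sum_(j < d) p ord0 j * complex.Re (x j).
Proof.
rewrite /cmean (big_morph (@complex.Re R) (id1 := 0) (op1 := +%R))//; last first.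
  by move=> [? ?] [? ?].
by apply: eq_bigr => j _; case: (x j) => a b /=; rewrite mul0r subr0.
Qed.

Lemma Im_cmean (R : realType) (d : nat) (x : 'I_d -> R[i]) (p : 'rV[R]_d) :
  complex.Im (cmean x p) = \sum_(j < d) p ord0 j * complex.Im (x j).
Proof.
rewrite /cmean (big_morph (@complex.Im R) (id1 := 0) (op1 := +%R))//; last first.
  by move=> [? ?] [? ?].
by apply: eq_bigr => j _; case: (x j) => a b /=; rewrite mul0r addr0.
Qed.

(** The cross term vanishes because the deviations from the mean average to
    zero.  Both sums are compared through the expansion of the mean squared
    distance to a point as a quadratic polynomial in that point. *)
Lemma bias_variance_real (R : comNzRingType) (d : nat) (p a : 'I_d -> R) (c : R) :
  \sum_i p i = 1 ->
  \sum_i p i * (a i - c) ^+ 2 =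
  \sum_i p i * (a i - \sum_j p j * a j) ^+ 2 + (\sum_j p j * a j - c) ^+ 2.
Proof.
move=> p1; set m := \sum_j p j * a j.
have expand u : \sum_i p i * (a i - u) ^+ 2 =
    \sum_i p i * a i ^+ 2 - (u *+ 2) * m + u ^+ 2.
  rewrite -[u ^+ 2 in RHS]mul1r -p1 /m mulr_sumr mulr_suml -sumrB -big_split/=.
  by apply: eq_bigr => i _; ring.
by rewrite !expand; ring.
Qed.

(** The squared modulus is a sum of squares of real coordinates, and the mean is
    taken coordinate by coordinate, so the real identity applies to each. *)
Lemma bias_variance (R : realType) (d : nat) (x : 'I_d -> R[i]) (p : 'rV[R]_d)
    (y : R[i]) :
  prob_vectors p ->
  \sum_i p ord0 i * cmod (x i - y) ^+ 2 =
  cvariance x p + cmod (cmean x p - y) ^+ 2.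
Proof.
move=> [_ p1]; rewrite /cvariance.
have split w : \sum_i p ord0 i * cmod (x i - w) ^+ 2 =
    \sum_i p ord0 i * (complex.Re (x i) - complex.Re w) ^+ 2 +
    \sum_i p ord0 i * (complex.Im (x i) - complex.Im w) ^+ 2.
  by rewrite -big_split; apply: eq_bigr => i _; rewrite cmod_sqrB mulrDr.
rewrite !split cmod_sqrB Re_cmean Im_cmean.
rewrite (bias_variance_real _ _ _ _ (complex.Re y) p1).
by rewrite (bias_variance_real _ _ _ _ (complex.Im y) p1) addrACA.
Qed.

(** The inequality between the two sides (weak duality): the bias term is
    nonnegative, and an average does not exceed the maximum. *)
Lemma cvariance_le_max_sqdist (R : realType) (d : nat) (x : 'I_d -> R[i])
    (p : 'rV[R]_d) (y : R[i]) :
  prob_vectors p -> cvariance x p <= max_sqdist x y.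
Proof.
move=> pP; have [p0 p1] := pP.
apply: (@le_trans _ _ (\sum_i p ord0 i * cmod (x i - y) ^+ 2)).
  by rewrite bias_variance// lerDl sqr_ge0.
rewrite -[leRHS]mul1r -p1 mulr_suml; apply: ler_sum => i _.
by rewrite ler_wpM2l//; exact: le_bigmax.
Qed.

Lemma continuous_sum_fin (R : realType) (T : topologicalType) (I : finType)
    (f : I -> T -> R) :
  (forall i, continuous (f i)) -> continuous (fun p => \sum_i f i p).
Proof.
move=> cf; apply: continuous_big => [|i _]; last exact: cf.
exact: add_continuous.
Qed.

Lemma continuous_cvariance (R : realType) (d : nat) (x : 'I_d -> R[i]) :
  continuous (cvariance x : 'rV[R]_d -> R).
Proof.
have csum (f : 'I_d -> R) :
    continuous (fun p : 'rV[R]_d => \sum_j p ord0 j * f j).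
  apply: continuous_sum_fin => j p.
  exact: (cvgM (@coord_continuous R 1 d ord0 j p) (cvg_cst (f j))).
have csqr (c : R) (f : 'I_d -> R) :
    continuous (fun p : 'rV[R]_d => (c - \sum_j p ord0 j * f j) ^+ 2).
  move=> p.
  have cB : {for p, continuous (fun p : 'rV[R]_d => c - \sum_j p ord0 j * f j)}.
    exact: (cvgB (cvg_cst c) (csum f p)).
  exact: (continuousM cB cB).
have -> : cvariance x = fun p : 'rV[R]_d => \sum_i p ord0 i *
    ((complex.Re (x i) - \sum_j p ord0 j * complex.Re (x j)) ^+ 2 +
     (complex.Im (x i) - \sum_j p ord0 j * complex.Im (x j)) ^+ 2).
  apply/funext => p; apply: eq_bigr => i _.
  by rewrite cmod_sqrB Re_cmean Im_cmean.
apply: continuous_sum_fin => i p.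
have cD : {for p, continuous (fun p : 'rV[R]_d =>
    (complex.Re (x i) - \sum_j p ord0 j * complex.Re (x j)) ^+ 2 +
    (complex.Im (x i) - \sum_j p ord0 j * complex.Im (x j)) ^+ 2)}.
  exact: (cvgD (csqr _ (fun j => complex.Re (x j)) p)
               (csqr _ (fun j => complex.Im (x j)) p)).
exact: (continuousM (@coord_continuous R 1 d ord0 i p) cD).
Qed.

Lemma compact_prob_vectors (R : realType) (d : nat) :
  compact (@prob_vectors R d).
Proof.
have csum : continuous (fun p : 'rV[R]_d => \sum_i p ord0 i).
  by apply: continuous_sum_fin => i; exact: coord_continuous.
have -> : @prob_vectors R d =
    [set p | forall i, `[0, 1]%classic (p ord0 i)] `&`
    (fun p => \sum_i p ord0 i) @^-1` [set 1].
  apply/seteqP; split=> p [p0 p1]; split=> // i; last first.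
    by have := p0 i; rewrite /= in_itv/= => /andP[].
  rewrite /= in_itv/= p0/= -p1 (bigD1 i)//= lerDl.
  by apply: sumr_ge0 => j _.
apply: compact_closedI.
  exact: (@rV_compact R d (fun=> `[0, 1]%classic) (fun=> @segment_compact R 0 1)).
exact: ((@continuous_closedP _ _ _).1 csum _ (@closed_eq R 1)).
Qed.

Lemma prob_vectors_delta (R : realType) (d : nat) (i : 'I_d) :
  prob_vectors (delta_mx 0 i : 'rV[R]_d).
Proof.
split=> [j|]; first by rewrite mxE ler0n.
by rewrite (bigD1 i)//= mxE !eqxx big1 ?addr0// => j /negbTE ji; rewrite mxE ji.
Qed.

Lemma prob_vectors_convex (R : realType) (d : nat) (p q : 'rV[R]_d) (t : R) :
  0 <= t <= 1 -> prob_vectors p -> prob_vectors q ->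
  prob_vectors ((1 - t) *: p + t *: q).
Proof.
move=> /andP[t0 t1] [p0 p1] [q0 q1]; split=> [j|].
  by rewrite !mxE addr_ge0// mulr_ge0// subr_ge0.
under eq_bigr do rewrite !mxE.
by rewrite big_split/= -!mulr_sumr p1 q1; ring.
Qed.

(** The mean moves from [m] to m + t (x_i - m).  The mean squared distance to the
    old mean [m] is linear in the weights, so it equals
    (1 - t) V + t |x_i - m|^2; the bias-variance identity says that it exceeds
    the new variance by the squared displacement t^2 |x_i - m|^2. *)
Lemma cvariance_toward_vertex (R : realType) (d : nat) (x : 'I_d -> R[i])
    (p : 'rV[R]_d) (i : 'I_d) (t : R) :
  0 <= t <= 1 -> prob_vectors p ->
  cvariance x ((1 - t) *: p + t *: delta_mx 0 i) =
  (1 - t) * cvariance x p + t * (1 - t) * cmod (x i - cmean x p) ^+ 2.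
Proof.
move=> t01 pP; set q := _ + _.
have sumq (f : 'I_d -> R) : \sum_j q ord0 j * f j =
    (1 - t) * (\sum_j p ord0 j * f j) + t * f i.
  have -> : f i = \sum_j (delta_mx 0 i : 'rV[R]_d) ord0 j * f j.
    rewrite (bigD1 i)//= mxE !eqxx mul1r big1 ?addr0// => j /negbTE ji.
    by rewrite mxE ji mul0r.
  rewrite !mulr_sumr -big_split/=; apply: eq_bigr => j _.
  by rewrite !mxE; ring.
have qP : prob_vectors q.
  by apply: prob_vectors_convex => //; exact: prob_vectors_delta.
have := @bias_variance R d x q (cmean x p) qP; rewrite sumq.
rewrite -/(cvariance x p) !cmod_sqrB !Re_cmean !Im_cmean !sumq => H.
apply/eqP; rewrite -subr_eq0; apply/eqP; move: H.
set V := cvariance x q; set V0 := cvariance x p; lra.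
Qed.

(** First-order optimality of a maximizer in the direction of a vertex of the
    simplex. *)
Lemma cvariance_maximizer_sqdist (R : realType) (d : nat) (x : 'I_d -> R[i])
    (p : 'rV[R]_d) (i : 'I_d) :
  prob_vectors p ->
  (forall q, prob_vectors q -> cvariance x q <= cvariance x p) ->
  cmod (x i - cmean x p) ^+ 2 <= cvariance x p.
Proof.
move=> pP pmax; set V := cvariance x p; set D := _ ^+ 2.
have V0 : 0 <= V.
  by apply: sumr_ge0 => j _; rewrite mulr_ge0 ?sqr_ge0//; case: pP.
rewrite leNgt; apply/negP => VD.
have D0 : 0 < D by exact: le_lt_trans VD.
(* With this [t], (1 - t) D is the midpoint of V and D, hence larger than V. *)
set t := (D - V) / (2 * D).
have tD : t * (2 * D) = D - V by rewrite divfK//; lra.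
have t0 : 0 < t by rewrite divr_gt0//; lra.
have t1 : t <= 1 by rewrite ler_pdivrMr; lra.
have t01 : 0 <= t <= 1 by rewrite ltW.
have := pmax _ (@prob_vectors_convex R d p (delta_mx 0 i) t t01 pP
  (@prob_vectors_delta R d i)).
rewrite cvariance_toward_vertex// -/V -/D => H.
have : t * ((1 - t) * D) <= t * V by lra.
by rewrite ler_pM2l// => H1; lra.
Qed.

Theorem theorem3 (R : realType) (d : nat) (hd : (0 < d)%N)
    (x : 'I_d -> R[i]) :
  exists v : R,
    is_maximum [set cvariance x p | p in @prob_vectors R d] v /\
    is_minimum [set max_sqdist x y | y in [set: R[i]]] v.
Proof.
have [p /set_mem pP pmax'] : exists2 p : 'rV[R]_d, p \in @prob_vectors R d &
    forall q, q \in @prob_vectors R d -> cvariance x q <= cvariance x p.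
  apply: compact_EVT_max; last exact/continuous_subspaceT/continuous_cvariance.
  - by exists (delta_mx 0 (Ordinal hd)); exact: prob_vectors_delta.
  - exact: compact_prob_vectors.
have pmax q : prob_vectors q -> cvariance x q <= cvariance x p.
  by move=> qP; apply: pmax'; exact: mem_set.
exists (cvariance x p); split; split.
- by exists p.
- by move=> _ [q qP <-]; exact: pmax.
- exists (cmean x p) => //; apply/eqP; rewrite eq_le.
  rewrite cvariance_le_max_sqdist// andbT; apply: bigmax_le => [|i _].
    by apply: sumr_ge0 => j _; rewrite mulr_ge0 ?sqr_ge0//; case: pP.
  exact: cvariance_maximizer_sqdist.
- by move=> _ [y _ <-]; exact: cvariance_le_max_sqdist.
Qed.
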